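(* Let a representation of the $1$-Weyl algebra (generated by $M,D,X$) on a complex vector space be given. For $j\in\mathbb Z$ put $G_j=jD+MX$ and $L_j=jM+DX$, and for $n,m\in\mathbb Z$ put $$H_{nm}=(n+m+1)M^2+DXM-(n+1),\qquad U_{nm}=\ker H_{nm}.$$ Then the Binomial grid, with vertex spaces $U_{nm}$ ($n,m\in\mathbb Z$) and arrows - East: $M:\ U_{nm}\to U_{n+1,m}$, - West: $L_{n+m}:\ U_{nm}\to U_{n-1,m}$, - North: $-D:\ U_{nm}\to U_{n,m+1}$, - South: $G_{n+m}:\ U_{nm}\to U_{n,m-1}$, is a well defined SIE grid: each listed operator maps the stated source space into the stated target space, and every circuit endomorphism of the grid is a scalar multiple of the identity. Moreover the following circuit endomorphisms $U_{nm}\to U_{nm}$ act as the stated scalars: - East narrow circuit: $L_{n+m+1}M=n+1$; - West narrow circuit: $ML_{n+m}=n$; - North narrow circuit: $G_{n+m+1}(-D)=m+1$; - South narrow circuit: $(-D)G_{n+m}=m$; - counterclockwise square circuit: $G_{n+m+1}\,L_{n+m+2}\,(-D)\,M=(n+1)(m+1)$; - clockwise square circuit: $L_{n+m+1}\,G_{n+m+2}\,M\,(-D)=(n+1)(m+1)$.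
   Context: The $1$-Weyl algebra (the $h$-Weyl algebra for $h=1$) is the associative unital $\mathbb C$-algebra generated by $M,D,X$ with relations $$[M,D]=0,\quad [M,X]=D,\quad [D,X]=M,\quad M^2-D^2=1,$$ where $[A,B]=AB-BA$. Kernels are taken in the given representation space. A grid here is a diagram of vector spaces indexed by vertices, with operators along arrows; a circuit is a closed path of composable arrows starting and ending at the same vertex, and its circuit endomorphism is the composition of the operators along it (rightmost first). A representation is called SIE (scalar intrinsic endomorphisms) if every circuit endomorphism is a scalar multiple of the identity of the corresponding vertex space. A scalar multiple of the identity is identified with the scalar; all displayed identities are identities of operators restricted to $U_{nm}$. *)

(* Defs.v *)
From HB Require Import structures.
From mathcomp Require Import all_boot all_order all_algebra.
From mathcomp Require Import generic_quotient boolp reals complex.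
From mathcomp Require Import ring.

Set Implicit Arguments.
Unset Strict Implicit.
Unset Printing Implicit Defensive.

Import Order.TTheory GRing.Theory Num.Theory.

Local Open Scope ring_scope.
Local Open Scope quotient_scope.

(* The 1-Weyl algebra is built as the K-algebra presented by three generators
   and their relations: formal noncommutative expressions modulo the least
   congruence containing the axioms of associative unital K-algebras and the
   four defining relations. *)
Inductive wexpr (K : Type) : Type :=
  | WCst of K
  | WM
  | WD
  | WX
  | WAdd of wexpr K & wexpr K
  | WMul of wexpr K & wexpr K.

Arguments WM {K}.
Arguments WD {K}.
Arguments WX {K}.

Definition wsub (K : pzRingType) (x y : wexpr K) : wexpr K :=
  WAdd x (WMul (WCst (-1)) y).

Definition wcomm (K : pzRingType) (x y : wexpr K) : wexpr K :=
  wsub (WMul x y) (WMul y x).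

Inductive weq (K : pzRingType) : wexpr K -> wexpr K -> Prop :=
  | weq_refl x : weq x x
  | weq_sym x y : weq x y -> weq y x
  | weq_trans y x z : weq x y -> weq y z -> weq x z
  | weq_add x x' y y' : weq x x' -> weq y y' -> weq (WAdd x y) (WAdd x' y')
  | weq_mul x x' y y' : weq x x' -> weq y y' -> weq (WMul x y) (WMul x' y')
  | weq_addA x y z : weq (WAdd x (WAdd y z)) (WAdd (WAdd x y) z)
  | weq_addC x y : weq (WAdd x y) (WAdd y x)
  | weq_add0 x : weq (WAdd (WCst 0) x) x
  | weq_mulA x y z : weq (WMul x (WMul y z)) (WMul (WMul x y) z)
  | weq_mul1 x : weq (WMul (WCst 1) x) x
  | weq_mul0 x : weq (WMul (WCst 0) x) (WCst 0)
  | weq_mulDl x y z : weq (WMul (WAdd x y) z) (WAdd (WMul x z) (WMul y z))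
  | weq_mulDr x y z : weq (WMul x (WAdd y z)) (WAdd (WMul x y) (WMul x z))
  | weq_cstD a b : weq (WCst (a + b)) (WAdd (WCst a) (WCst b))
  | weq_cstM a b : weq (WCst (a * b)) (WMul (WCst a) (WCst b))
  | weq_cstC a x : weq (WMul (WCst a) x) (WMul x (WCst a))
  | weq_MD : weq (wcomm WM WD) (WCst 0)
  | weq_MX : weq (wcomm WM WX) WD
  | weq_DX : weq (wcomm WD WX) WM
  | weq_MMDD : weq (wsub (WMul WM WM) (WMul WD WD)) (WCst 1).

HB.instance Definition _ (K : Type) := gen_eqMixin (wexpr K).
HB.instance Definition _ (K : Type) := gen_choiceMixin (wexpr K).

Section WeylAlgebra.
Variable K : numFieldType.

Definition weqb (x y : wexpr K) : bool := `[< weq x y >].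

Lemma weqb_equiv : equiv_class_of weqb.
Proof.
split.
- by move=> x; apply/asboolP; apply: weq_refl.
- move=> x y; apply/idP/idP => /asboolP h; apply/asboolP; exact: weq_sym.
- move=> y x z /asboolP h1 /asboolP h2; apply/asboolP.
  exact: weq_trans h1 h2.
Qed.

Canonical weqb_equivRel := EquivRelPack weqb_equiv.

Definition weyl := {eq_quot weqb}.

HB.instance Definition _ := Choice.on weyl.

Definition wpi (x : wexpr K) : weyl := \pi_weyl x.

Lemma wpiP x y : wpi x = wpi y <-> weq x y.
Proof.
split=> [/eqquotP/asboolP //| h]; apply/eqquotP; exact/asboolP.
Qed.

Lemma wpi_repr (a : weyl) : wpi (repr a) = a.
Proof. exact: reprK. Qed.

Lemma repr_wpi x : weq (repr (wpi x)) x.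
Proof. by apply/wpiP; rewrite wpi_repr. Qed.

Definition weyl_cst (a : K) : weyl := wpi (WCst a).
Definition weyl_add (a b : weyl) : weyl := wpi (WAdd (repr a) (repr b)).
Definition weyl_mul (a b : weyl) : weyl := wpi (WMul (repr a) (repr b)).
Definition weyl_opp (a : weyl) : weyl := weyl_mul (weyl_cst (-1)) a.
Definition weyl_scale (a : K) (b : weyl) : weyl := weyl_mul (weyl_cst a) b.

Lemma wpi_add x y : weyl_add (wpi x) (wpi y) = wpi (WAdd x y).
Proof. by apply/wpiP; apply: weq_add; apply: repr_wpi. Qed.

Lemma wpi_mul x y : weyl_mul (wpi x) (wpi y) = wpi (WMul x y).
Proof. by apply/wpiP; apply: weq_mul; apply: repr_wpi. Qed.

Lemma wpi_ind (P : weyl -> Prop) : (forall x, P (wpi x)) -> forall a, P a.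
Proof. by move=> h a; rewrite -(wpi_repr a). Qed.

Lemma weyl_addA : associative weyl_add.
Proof.
elim/wpi_ind=> x; elim/wpi_ind=> y; elim/wpi_ind=> z; rewrite !wpi_add.
by apply/wpiP; apply: weq_addA.
Qed.

Lemma weyl_addC : commutative weyl_add.
Proof.
elim/wpi_ind=> x; elim/wpi_ind=> y; rewrite !wpi_add.
by apply/wpiP; apply: weq_addC.
Qed.

Lemma weyl_add0 : left_id (weyl_cst 0) weyl_add.
Proof.
by elim/wpi_ind=> x; rewrite wpi_add; apply/wpiP; apply: weq_add0.
Qed.

Lemma weyl_mulA : associative weyl_mul.
Proof.
elim/wpi_ind=> x; elim/wpi_ind=> y; elim/wpi_ind=> z; rewrite !wpi_mul.
by apply/wpiP; apply: weq_mulA.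
Qed.

Lemma weyl_mul1 : left_id (weyl_cst 1) weyl_mul.
Proof.
by elim/wpi_ind=> x; rewrite wpi_mul; apply/wpiP; apply: weq_mul1.
Qed.

Lemma weyl_mul0 : left_zero (weyl_cst 0) weyl_mul.
Proof.
by elim/wpi_ind=> x; rewrite wpi_mul; apply/wpiP; apply: weq_mul0.
Qed.

Lemma weyl_mulDl : left_distributive weyl_mul weyl_add.
Proof.
elim/wpi_ind=> x; elim/wpi_ind=> y; elim/wpi_ind=> z.
by rewrite !(wpi_add, wpi_mul); apply/wpiP; apply: weq_mulDl.
Qed.

Lemma weyl_mulDr : right_distributive weyl_mul weyl_add.
Proof.
elim/wpi_ind=> x; elim/wpi_ind=> y; elim/wpi_ind=> z.
by rewrite !(wpi_add, wpi_mul); apply/wpiP; apply: weq_mulDr.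
Qed.

Lemma weyl_cstC a : forall x, weyl_mul (weyl_cst a) x = weyl_mul x (weyl_cst a).
Proof.
by elim/wpi_ind=> x; rewrite !wpi_mul; apply/wpiP; apply: weq_cstC.
Qed.

Lemma weyl_cstD a b : weyl_cst (a + b) = weyl_add (weyl_cst a) (weyl_cst b).
Proof. by rewrite wpi_add; apply/wpiP; apply: weq_cstD. Qed.

Lemma weyl_cstM a b : weyl_cst (a * b) = weyl_mul (weyl_cst a) (weyl_cst b).
Proof. by rewrite wpi_mul; apply/wpiP; apply: weq_cstM. Qed.

Lemma weyl_mulr1 : right_id (weyl_cst 1) weyl_mul.
Proof. by move=> x; rewrite -weyl_cstC weyl_mul1. Qed.

Lemma weyl_addN : left_inverse (weyl_cst 0) weyl_opp weyl_add.
Proof.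
move=> x; rewrite -{2}[x]weyl_mul1 /weyl_opp -weyl_mulDl -weyl_cstD addNr.
exact: weyl_mul0.
Qed.

(* Consistency of the presentation: the relations hold for the operators
   M = (S + S^-1)/2, D = (S - S^-1)/2, (X f)(k) = - k f(k) on the functions
   f : int -> K, where (S f)(k) = f(k - 1). *)
Fixpoint wshift (x : wexpr K) (f : int -> K) (k : int) : K :=
  match x with
  | WCst a => a * f k
  | WM => (f (k - 1) + f (k + 1)) / 2%:R
  | WD => (f (k - 1) - f (k + 1)) / 2%:R
  | WX => - k%:~R * f k
  | WAdd x y => wshift x f k + wshift y f k
  | WMul x y => wshift x (wshift y f) k
  end.

Lemma wshift_lin x (a b : K) f g k :
  wshift x (fun i => a * f i + b * g i) k = a * wshift x f k + b * wshift x g k.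
Proof.
elim: x f g k => [c|||| x IHx y IHy|x IHx y IHy] f g k /=; try by field.
- by rewrite IHx IHy; ring.
- by rewrite -IHx; congr wshift; apply/funext => i; rewrite IHy.
Qed.

Lemma wshift_weq x y : weq x y -> forall f k, wshift x f k = wshift y f k.
Proof.
have int1 (k : int) : ((k - 1)%:~R = k%:~R - 1 :> K)
    * ((k + 1)%:~R = k%:~R + 1 :> K) by split; rewrite ?intrB ?intrD.
have shiftK (k : int) : (k - 1 + 1 = k) * (k + 1 - 1 = k).
  by split; [apply: subrK | apply: addrK].
elim=> /= {x y}.
- by [].
- by move=> x y _ h f k; rewrite h.
- by move=> y x z _ h1 _ h2 f k; rewrite h1.
- by move=> x x' y y' _ h1 _ h2 f k; rewrite h1 h2.
- move=> x x' y y' _ h1 _ h2 f k; rewrite h1; congr wshift.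
  exact/funext.
- by move=> *; ring.
- by move=> *; ring.
- by move=> *; ring.
- by [].
- by move=> *; ring.
- by move=> *; ring.
- by [].
- move=> x y z f k; rewrite -[RHS](congr2 +%R (mul1r _) (mul1r _)) -wshift_lin.
  by congr wshift; apply/funext => i; rewrite !mul1r.
- by move=> *; ring.
- by move=> *; ring.
- move=> a x f k; rewrite -[LHS]addr0 -[X in _ + X](mul0r (wshift x f k)).
  rewrite -wshift_lin; congr wshift; apply/funext => i; ring.
- by move=> f k; rewrite !shiftK; field.
- by move=> f k; rewrite !int1; field.
- by move=> f k; rewrite !int1; field.
- by move=> f k; rewrite !shiftK; field.
Qed.

Lemma weyl_1neq0 : weyl_cst 1 != weyl_cst 0.
Proof.
apply/eqP => /wpiP /wshift_weq /(_ (fun=> 1) 0) /= /eqP.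
by rewrite !mulr1 oner_eq0.
Qed.

HB.instance Definition _ := GRing.isZmodule.Build weyl
  weyl_addA weyl_addC weyl_add0 weyl_addN.

HB.instance Definition _ := GRing.Zmodule_isNzRing.Build weyl
  weyl_mulA weyl_mul1 weyl_mulr1 weyl_mulDl weyl_mulDr weyl_1neq0.

Lemma weyl_scaleA a b v :
  weyl_scale a (weyl_scale b v) = weyl_scale (a * b) v.
Proof. by rewrite /weyl_scale weyl_mulA -weyl_cstM. Qed.

Lemma weyl_scaleDl (v : weyl) :
  {morph weyl_scale^~ v : a b / a + b >-> a + b}.
Proof. by move=> a b; rewrite /weyl_scale weyl_cstD weyl_mulDl. Qed.

HB.instance Definition _ := GRing.Zmodule_isLmodule.Build K weyl
  weyl_scaleA weyl_mul1 (fun a => weyl_mulDr (weyl_cst a)) weyl_scaleDl.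

Lemma weyl_scaleAl (a : K) (u v : weyl) : a *: (u * v) = (a *: u) * v.
Proof. exact: weyl_mulA. Qed.

HB.instance Definition _ := GRing.Lmodule_isLalgebra.Build K weyl weyl_scaleAl.

Lemma weyl_scaleAr (a : K) (u v : weyl) : a *: (u * v) = u * (a *: v).
Proof.
change (weyl_mul (weyl_cst a) (weyl_mul u v) =
        weyl_mul u (weyl_mul (weyl_cst a) v)).
by rewrite !weyl_mulA weyl_cstC.
Qed.

HB.instance Definition _ := GRing.Lalgebra_isAlgebra.Build K weyl weyl_scaleAr.

Definition wM : weyl := wpi WM.
Definition wD : weyl := wpi WD.
Definition wX : weyl := wpi WX.

Lemma wpi_sub x y : wpi (wsub x y) = wpi x - wpi y.
Proof. by rewrite /wsub -wpi_add -wpi_mul. Qed.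

Lemma wpi_mulE x y : wpi (WMul x y) = wpi x * wpi y.
Proof. by rewrite -wpi_mul. Qed.

Lemma weyl_commE x y : wpi (wcomm x y) = wpi x * wpi y - wpi y * wpi x.
Proof. by rewrite wpi_sub !wpi_mulE. Qed.

Lemma weyl_MD : wM * wD - wD * wM = 0.
Proof. by rewrite -[LHS]weyl_commE; apply/wpiP/weq_MD. Qed.

Lemma weyl_MX : wM * wX - wX * wM = wD.
Proof. by rewrite -[LHS]weyl_commE; apply/wpiP/weq_MX. Qed.

Lemma weyl_DX : wD * wX - wX * wD = wM.
Proof. by rewrite -[LHS]weyl_commE; apply/wpiP/weq_DX. Qed.

Lemma weyl_MMDD : wM ^+ 2 - wD ^+ 2 = 1.
Proof. by rewrite !expr2 -!wpi_mulE -wpi_sub; apply/wpiP/weq_MMDD. Qed.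

Definition wG (j : int) : weyl := j%:~R * wD + wM * wX.
Definition wL (j : int) : weyl := j%:~R * wM + wD * wX.
Definition wH (n m : int) : weyl :=
  (n + m + 1)%:~R * wM ^+ 2 + wD * wX * wM - (n + 1)%:~R.

End WeylAlgebra.

Arguments wM {K}.
Arguments wD {K}.
Arguments wX {K}.
Arguments wG {K} j.
Arguments wL {K} j.
Arguments wH {K} n m.

Record representation (K : fieldType) (A : algType K) (V : lmodType K) :=
  Representation {
    rep_act :> A -> {linear V -> V};
    rep_linear : forall v, linear (rep_act^~ v);
    rep_unit : forall v, rep_act 1 v = v;
    rep_mul : forall a b v, rep_act (a * b) v = rep_act a (rep_act b v)
  }.

(* The kernel of a linear map, as a vector space in its own right. *)
Section Kernel.
Variables (K : fieldType) (V W : lmodType K) (f : {linear V -> W}).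

Record ker := Ker { ker_val : V; ker_valP : f ker_val == 0 }.

HB.instance Definition _ := [isSub for ker_val].
HB.instance Definition _ := [Choice of ker by <:].

Fact ker_submod_closed : submod_closed (fun v => f v == 0).
Proof.
split=> [|a u v]; rewrite ?inE unfold_in; first by rewrite linear0.
by move=> /eqP fu /eqP fv; rewrite unfold_in linearP fu fv scaler0 addr0.
Qed.

HB.instance Definition _ :=
  GRing.SubChoice_isSubLmodule.Build K V (fun v => f v == 0) ker
    ker_submod_closed.

End Kernel.

Definition maps_ker (K : fieldType) (V : lmodType K)
    (f h h' : {linear V -> V}) : Prop :=
  forall v, h v = 0 -> h' (f v) = 0.

Section KernelMap.
Variables (K : fieldType) (V : lmodType K) (f h h' : {linear V -> V}).
Hypothesis fP : maps_ker f h h'.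

Fact ker_map_subproof (u : ker h) : h' (f (val u)) == 0.
Proof. by apply/eqP/fP/eqP/ker_valP. Qed.

Definition ker_map (u : ker h) : ker h' := Ker (ker_map_subproof u).

Fact ker_map_linear : linear ker_map.
Proof. by move=> a u v; apply: val_inj; rewrite /= linearP. Qed.

HB.instance Definition _ :=
  GRing.isLinear.Build K (ker h) (ker h') *:%R ker_map ker_map_linear.

End KernelMap.

Record grid (K : fieldType) := Grid {
  vertex : Type;
  arrow : vertex -> vertex -> Type;
  vspace_at : vertex -> lmodType K;
  arrow_op : forall a b, arrow a b -> {linear vspace_at a -> vspace_at b}
}.

Section Circuits.
Variables (K : fieldType) (g : grid K).

Inductive gpath (a : vertex g) : vertex g -> Type :=
  | Stay : gpath a a
  | Step b c : gpath a b -> arrow b c -> gpath a c.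

Fixpoint gpath_op a b (p : gpath a b) : vspace_at a -> vspace_at b :=
  match p with
  | Stay => id
  | Step _ _ p e => fun u => arrow_op e (gpath_op p u)
  end.

Definition circuit (a : vertex g) : Type := gpath a a.

Definition SIE : Prop :=
  forall (a : vertex g) (p : circuit a),
    exists c : K, forall u, gpath_op p u = c *: u.

End Circuits.

Section BinomialGrid.
Variables (K : numFieldType) (V : lmodType K) (rho : representation (weyl K) V).

Definition U (n m : int) : lmodType K := ker (rho (wH n m)).

Record binomial_wd : Prop := BinomialWd {
  east_wd : forall n m,
    maps_ker (rho wM) (rho (wH n m)) (rho (wH (n + 1) m));
  west_wd : forall n m,
    maps_ker (rho (wL (n + m))) (rho (wH n m)) (rho (wH (n - 1) m));
  north_wd : forall n m,
    maps_ker (rho (- wD)) (rho (wH n m)) (rho (wH n (m + 1)));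
  south_wd : forall n m,
    maps_ker (rho (wG (n + m))) (rho (wH n m)) (rho (wH n (m - 1)))
}.

(* Targets are given up to a propositional equation, since n + 1 - 1 and n are
   not convertible: otherwise no circuit could be written down. *)
Inductive binomial_arrow : int * int -> int * int -> Type :=
  | East n m n' of n' = n + 1 : binomial_arrow (n, m) (n', m)
  | West n m n' of n' = n - 1 : binomial_arrow (n, m) (n', m)
  | North n m m' of m' = m + 1 : binomial_arrow (n, m) (n, m')
  | South n m m' of m' = m - 1 : binomial_arrow (n, m) (n, m').

Fact east_map n m n' : binomial_wd -> n' = n + 1 ->
  maps_ker (rho wM) (rho (wH n m)) (rho (wH n' m)).
Proof. by move=> wd ->; apply: east_wd. Qed.

Fact west_map n m n' : binomial_wd -> n' = n - 1 ->
  maps_ker (rho (wL (n + m))) (rho (wH n m)) (rho (wH n' m)).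
Proof. by move=> wd ->; apply: west_wd. Qed.

Fact north_map n m m' : binomial_wd -> m' = m + 1 ->
  maps_ker (rho (- wD)) (rho (wH n m)) (rho (wH n m')).
Proof. by move=> wd ->; apply: north_wd. Qed.

Fact south_map n m m' : binomial_wd -> m' = m - 1 ->
  maps_ker (rho (wG (n + m))) (rho (wH n m)) (rho (wH n m')).
Proof. by move=> wd ->; apply: south_wd. Qed.

Definition binomial_op (wd : binomial_wd) a b (e : binomial_arrow a b) :
    {linear U a.1 a.2 -> U b.1 b.2} :=
  match e in binomial_arrow a b return {linear U a.1 a.2 -> U b.1 b.2} with
  | East n m n' en => ker_map (east_map (m := m) wd en)
  | West n m n' en => ker_map (west_map (m := m) wd en)
  | North n m m' em => ker_map (north_map (n := n) wd em)
  | South n m m' em => ker_map (south_map (n := n) wd em)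
  end.

Definition binomial_grid (wd : binomial_wd) : grid K :=
  {| vertex := int * int;
     arrow := binomial_arrow;
     vspace_at := fun a => U a.1 a.2;
     arrow_op := binomial_op wd |}.

Variable wd : binomial_wd.

Let g := binomial_grid wd.
Let e n m : @arrow K g (n, m) (n + 1, m) := East m erefl.
Let w n m : @arrow K g (n, m) (n - 1, m) := West m erefl.
Let no n m : @arrow K g (n, m) (n, m + 1) := North n erefl.
Let so n m : @arrow K g (n, m) (n, m - 1) := South n erefl.
Let e' n m : @arrow K g (n - 1, m) (n, m) := East m (esym (subrK 1 n)).
Let w' n m : @arrow K g (n + 1, m) (n, m) := West m (esym (addrK 1 n)).
Let no' n m : @arrow K g (n, m - 1) (n, m) := North n (esym (subrK 1 m)).
Let so' n m : @arrow K g (n, m + 1) (n, m) := South n (esym (addrK 1 m)).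

Section Named.
Variables n m : int.

Definition east_narrow : @circuit K g (n, m) :=
  Step (Step (Stay _) (e n m)) (w' n m).
Definition west_narrow : @circuit K g (n, m) :=
  Step (Step (Stay _) (w n m)) (e' n m).
Definition north_narrow : @circuit K g (n, m) :=
  Step (Step (Stay _) (no n m)) (so' n m).
Definition south_narrow : @circuit K g (n, m) :=
  Step (Step (Stay _) (so n m)) (no' n m).
Definition ccw_square : @circuit K g (n, m) :=
  Step (Step (Step (Step (Stay _) (e n m)) (no (n + 1) m)) (w' n (m + 1)))
    (so' n m).
Definition cw_square : @circuit K g (n, m) :=
  Step (Step (Step (Step (Stay _) (no n m)) (e n (m + 1))) (so' (n + 1) m))
    (w' n m).

(* The circuit p is the restriction to U n m of the operator t, and that
   restriction is the scalar c. *)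
Definition circuit_is (p : @circuit K g (n, m)) (t : weyl K) (c : K) : Prop :=
  forall u : U n m, val (gpath_op p u) = rho t (val u) /\ gpath_op p u = c *: u.

End Named.

End BinomialGrid.

(* Main.v *)
(** Up to an additive scalar, [wH n m] is the product of the two opposite arrows
    along each of the four edges at (n, m). Hence the arrows intertwine these
    operators, and going back and forth along an edge is a scalar. Moreover
    horizontal arrows commute with vertical ones. So any path from (n, m) to
    (n', m') is a scalar multiple of the monotone horizontal walk from n to n'
    followed by the monotone vertical walk from m to m', by induction on the
    path: a new horizontal arrow is first moved across the vertical walk, and an
    arrow added to a monotone walk either prolongs it or cancels its last arrow
    up to a scalar. For a circuit both walks are empty. *)
Require Import Defs.
From mathcomp Require Import all_boot all_order all_algebra.
From mathcomp Require Import reals complex.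
From mathcomp Require Import ring.

Set Implicit Arguments.
Unset Strict Implicit.
Unset Printing Implicit Defensive.

Import Order.TTheory GRing.Theory Num.Theory.
Local Open Scope ring_scope.
Local Open Scope complex_scope.

(** * Products and commutations in the Weyl algebra *)

Section WeylIdentities.
Variable K : numFieldType.
Local Notation M := (@wM K).
Local Notation D := (@wD K).
Local Notation X := (@wX K).
Implicit Types j n m : int.

Lemma wMDC : M * D = D * M.
Proof. by apply/eqP; rewrite -subr_eq0 weyl_MD. Qed.

Lemma wMX : M * X = X * M + D.
Proof. by rewrite -weyl_MX addrC subrK. Qed.

Lemma wDX : D * X = X * D + M.
Proof. by rewrite -weyl_DX addrC subrK. Qed.

Lemma wXM : X * M = M * X - D.
Proof. by rewrite wMX addrK. Qed.

Lemma wXD : X * D = D * X - M.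
Proof. by rewrite wDX addrK. Qed.

Lemma wMM : M * M = D * D + 1.
Proof. by rewrite -weyl_MMDD !expr2 addrC subrK. Qed.

Lemma wGE j : wG j = D *~ j + M * X.
Proof. by rewrite /wG mulrzl. Qed.

Lemma wLE j : wL j = M *~ j + D * X.
Proof. by rewrite /wL mulrzl. Qed.

Lemma wHE n m : wH n m = M * M *~ (n + m + 1) + D * X * M - (n + 1)%:~R.
Proof. by rewrite /wH mulrzl expr2. Qed.

Lemma wL_wM n m : wL (n + m + 1) * M = wH n m + (n + 1)%:~R.
Proof. by rewrite wHE subrK wLE mulrDl mulrzAl. Qed.

(** [wMM] trades one of the n + m + 1 copies of M M for D D + 1, and this 1 lowers the constant n +
    1 to n. *)
Lemma wHE_wM n m :
  wH n m = M * M *~ (n + m) + D * X * M + D * D - n%:~R.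
Proof.
rewrite wHE mulrzDr mulr1z [X in _ + X + _ - _]wMM [_ + _ + D * X * M]addrAC !addrA.
by rewrite intrD [n%:~R + 1]addrC opprD addrA addrK.
Qed.

(** Trading the other n + m copies as well turns the constant -n into m, the scalar of the vertical
    edges. *)
Lemma wHE_wD n m :
  wH n m = D * D *~ (n + m) + D * X * M + D * D + m%:~R.
Proof.
rewrite wHE_wM wMM mulrzDl [_ + _ + D * X * M]addrAC [_ + _ + D * D]addrAC.
by rewrite intrD [n%:~R + _]addrC addrA addrK.
Qed.

Lemma wM_wL n m : M * wL (n + m) = wH n m + n%:~R.
Proof.
rewrite wHE_wM subrK wLE mulrDr mulrzAr mulrA wMDC -[D * M * X]mulrA wMX.
by rewrite mulrDr !mulrA addrA.
Qed.

Lemma wND_wG n m : - D * wG (n + m) = m%:~R - wH n m.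
Proof.
rewrite wHE_wD opprD addrCA subrr addr0 mulNr; congr (- _).
by rewrite wGE mulrDr mulrzAr wMX mulrDr mulrA addrA.
Qed.

Lemma wG_wND n m : wG (n + m + 1) * - D = (m + 1)%:~R - wH n m.
Proof.
have MXD : M * X * D = D * X * M - 1.
  by rewrite -mulrA wXD mulrBr mulrA wMDC -[D * M * X]mulrA wMX mulrDr mulrA wMM opprD addrA addrK.
rewrite wHE_wD wGE mulrN mulrDl mulrzAl mulrzDr mulr1z MXD intrD.
rewrite [_ + m%:~R]addrC [m%:~R + 1]addrC [X in _ = _ + X]opprD [RHS]addrA addrK.
by rewrite addrA opprB [_ + D * D + _]addrAC.
Qed.

(** M M X = M X M + M D, and the extra M D raises the index by one. *)
Lemma wM_wG j : M * wG j = wG (j + 1) * M.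
Proof.
rewrite !wGE mulrDr mulrDl mulrzAr mulrzAl mulrzDr mulr1z wMDC.
by rewrite {1}wMX mulrDr !mulrA [M * D]wMDC [_ + D * M]addrC addrA.
Qed.

Lemma wD_wL j : D * wL j = wL (j + 1) * D.
Proof.
rewrite !wLE mulrDr mulrDl mulrzAr mulrzAl mulrzDr mulr1z wMDC.
by rewrite {1}wDX mulrDr !mulrA [_ + D * M]addrC addrA.
Qed.

(** Lowering an index subtracts M from [wL] and D from [wG]. The two errors cancel, since L_j G_j -
    G_j L_j and M G_j - D L_j both equal X. *)
Lemma wL_wG j : wL (j - 1) * wG j = wG (j - 1) * wL j :> weyl K.
Proof.
(* Moving X to the right end reduces this to M M - D D. *)
have DXM : D * X * M - M * X * D = 1.
  rewrite -[M * X * D]mulrA -[D * X * M]mulrA wXD wXM.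
  by rewrite !mulrBr opprB !mulrA wMDC addrC addrA subrK wMM addrAC subrr add0r.
have LG : wL j * wG j = X + wG j * wL j.
  have DXMX : D * X * (M * X) = X + M * X * (D * X).
    by rewrite !mulrA -{1}[D * X * M](subrK (M * X * D)) DXM mulrDl mul1r.
  rewrite wGE wLE !mulrDl !mulrDr !mulrzAl !mulrzAr DXMX wMDC.
  rewrite -[D * X * D]mulrA -[M * X * M]mulrA wXD wXM !mulrBr wMDC.
  (* Both sides now have the same six summands; X is the fifth on the left and the first on the
     right. *)
  by rewrite !mulrzBl (AC (2*(2*2)) (5*((1*3)*((2*4)*6)))).
have LB i : wL (i - 1) = wL i - M by rewrite !wLE mulrzBr mulr1z addrAC.
have GB i : wG (i - 1) = wG i - D by rewrite !wGE mulrzBr mulr1z addrAC.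
have MG_DL : M * wG j = X + D * wL j.
  rewrite wGE wLE !mulrDr !mulrzAr !mulrA wMDC wMM mulrDl mul1r.
  by rewrite addrA addrC.
by rewrite LB GB !mulrBl LG MG_DL opprD addrACA subrr add0r.
Qed.

End WeylIdentities.

(** * Additivity of a representation *)

Section Representation.
Variables (K : fieldType) (A : algType K) (V : lmodType K).
Variable rho : representation A V.

Lemma repP k a b v : rho (k *: a + b) v = k *: rho a v + rho b v.
Proof. exact: rep_linear. Qed.

Lemma repB a b v : rho (a - b) v = rho a v - rho b v.
Proof. by have := repP (-1) b a v; rewrite !scaleN1r ![- _ + _]addrC. Qed.

Lemma rep0 v : rho 0 v = 0.
Proof. by rewrite -[X in rho X](subrr 0) repB subrr. Qed.

Lemma repN a v : rho (- a) v = - rho a v.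
Proof. by rewrite -[- a]add0r repB rep0 add0r. Qed.

Lemma repD a b v : rho (a + b) v = rho a v + rho b v.
Proof. by rewrite -[b]opprK repB !repN !opprK. Qed.

Lemma rep_int (z : int) v : rho z%:~R v = z%:~R *: v.
Proof.
by rewrite -[_%:~R]addr0 -scaler_int repP rep_unit rep0 addr0.
Qed.

End Representation.

(** * Operators of monotone walks *)

Section Climb.
Variables (A : pzRingType) (up : A) (dn : int -> A).

Fixpoint descent (j : int) (i : nat) : A :=
  if i is i'.+1 then dn (j - i'%:Z) * descent j i' else 1.

(* The operator of the monotone walk of [k] steps (down if [k < 0]) that starts at
   level [j]; the level decreases by 1 at each step of a descent. *)
Definition climb (j k : int) : A :=
  match k with Posz i => up ^+ i | Negz i => descent j i.+1 end.

Lemma climb0 j : climb j 0 = 1.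
Proof. by []. Qed.

Lemma climbN j (i : nat) : climb j (- i%:Z) = descent j i.
Proof. by case: i. Qed.

(** Here [f] is a transverse arrow indexed by its starting level, and [d] the change of level it
    makes: 1 for [wM], -1 for [wL]. Commuting squares are glued along the walk. *)
Lemma climb_crossing (f : int -> A) (d : int) :
    (forall j, f (j + 1) * up = up * f j) ->
    (forall j, f (j - 1) * dn j = dn (j + d) * f j) ->
  forall j k, f (j + k) * climb j k = climb (j + d) k * f j.
Proof.
move=> fup fdn j.
have fdescent (i : nat) : f (j - i%:Z) * descent j i = descent (j + d) i * f j.
  elim: i => [|i IHi] /=; first by rewrite subr0 mulr1 mul1r.
  rewrite mulrA -addn1 PoszD opprD addrA fdn -!mulrA -IHi !mulrA.
  by rewrite addrAC.
case=> [i|i]; last by rewrite NegzE climbN fdescent.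
elim: i => [|i IHi] /=; first by rewrite addr0 !expr0 mulr1 mul1r.
by rewrite -addn1 PoszD addrA addn1 !exprS mulrA fup -!mulrA IHi.
Qed.

End Climb.

(** * Walks along one row or column *)

Section Ladder.
Variables (K : fieldType) (A : algType K) (V : lmodType K).
Variable rho : representation A V.

(* [S n] is the kernel at position [n] of a row or column of the grid, and [s] is the
   other coordinate, so that [n + s] is the level that indexes the down arrows. *)
Record ladder (S : int -> V -> Prop) (s : int) (up : A) (dn : int -> A) :=
  Ladder {
    up_mem : forall n v, S n v -> S (n + 1) (rho up v);
    dn_mem : forall n v, S n v -> S (n - 1) (rho (dn (n + s)) v);
    dn_up : forall n v, S n v ->
      rho (dn (n + s + 1)) (rho up v) = (n + 1)%:~R *: v;
    up_dn : forall n v, S n v -> rho up (rho (dn (n + s)) v) = n%:~R *: v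
  }.

Variables (S : int -> V -> Prop) (s : int) (up : A) (dn : int -> A).
Variable lad : ladder S s up dn.

Lemma climb_mem n k v : S n v -> S (n + k) (rho (climb up dn (n + s) k) v).
Proof.
move=> Sv; case: k => i.
  elim: i => [|i IHi] /=; first by rewrite addr0 expr0 rep_unit.
  by rewrite exprS rep_mul -addn1 PoszD addrA; apply: up_mem lad _ _ IHi.
rewrite NegzE; elim: i.+1 => {i} [|i IHi].
  by rewrite oppr0 addr0 rep_unit.
rewrite climbN /= -(climbN up) rep_mul -addn1 PoszD opprD addrA.
by rewrite [n + s - _]addrAC; apply: dn_mem lad _ _ IHi.
Qed.

Lemma up_climb n k : exists c, forall v, S n v ->
  rho (up * climb up dn (n + s) k) v = c *: rho (climb up dn (n + s) (k + 1)) v.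
Proof.
case: k => [i|i].
  exists 1 => v _; rewrite scale1r -PoszD addn1.
  by rewrite -exprS.
(* [Negz i] is -(i + 1), so the last arrow down, now cancelled through [up_dn], starts at n - i. *)
exists (n - i%:Z)%:~R => v Sv.
have -> : Negz i + 1 = - i%:Z by rewrite NegzE -addn1 PoszD opprD subrK.
rewrite climbN /= !rep_mul addrAC.
apply: (up_dn lad); rewrite -(climbN up); exact: climb_mem.
Qed.

Lemma dn_climb n k : exists c, forall v, S n v ->
  rho (dn (n + k + s) * climb up dn (n + s) k) v =
  c *: rho (climb up dn (n + s) (k - 1)) v.
Proof.
case: k => [[|i]|i].
(* From the empty walk, the down arrow begins a descent. *)
- exists 1 => v _; rewrite scale1r addr0 sub0r (climbN _ _ _ 1) /= expr0.
  by rewrite subr0.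
(* The last arrow up starts at n + i, where [dn_up] gives this scalar. *)
- exists (n + i%:Z + 1)%:~R => v Sv.
  have -> : Posz i.+1 - 1 = i by rewrite -addn1 PoszD addrK.
  have -> : n + i.+1%:Z + s = n + i%:Z + s + 1.
    by rewrite -addn1 PoszD addrA [LHS]addrAC.
  rewrite /= exprS !rep_mul.
  exact: (dn_up lad (climb_mem i Sv)).
- exists 1 => v _; rewrite scale1r.
  have -> : Negz i - 1 = - i.+2%:Z by rewrite NegzE -opprD -PoszD addn1.
  by rewrite climbN /= NegzE addrAC.
Qed.

End Ladder.

(** * Straightening paths in the Binomial grid *)

Section Binomial.
Variables (K : numFieldType) (V : lmodType K) (rho : representation (weyl K) V).

(** The back-and-forth scalars come first and imply membership: at the target, [wH] is the product
    of the two opposite arrows along the edge just crossed, minus its scalar. *)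
Lemma horizontal_ladder m :
  ladder rho (fun n v => rho (wH n m) v = 0) m wM wL.
Proof.
have dnup n v : rho (wH n m) v = 0 ->
    rho (wL (n + m + 1)) (rho wM v) = (n + 1)%:~R *: v.
  by move=> Hv; rewrite -rep_mul wL_wM repD Hv add0r rep_int.
have updn n v : rho (wH n m) v = 0 ->
    rho wM (rho (wL (n + m)) v) = n%:~R *: v.
  by move=> Hv; rewrite -rep_mul wM_wL repD Hv add0r rep_int.
split=> // n v Hv.
  rewrite -[wH _ _](addrK (n + 1)%:~R) -wM_wL repB rep_mul addrAC dnup //.
  by rewrite linearZ rep_int subrr.
rewrite -[wH _ _](addrK (n - 1 + 1)%:~R) -wL_wM repB rep_mul subrK.
by rewrite addrAC subrK updn // linearZ rep_int subrr.
Qed.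

Lemma vertical_ladder n :
  ladder rho (fun m v => rho (wH n m) v = 0) n (- wD) wG.
Proof.
have dnup m v : rho (wH n m) v = 0 ->
    rho (wG (m + n + 1)) (rho (- wD) v) = (m + 1)%:~R *: v.
  by move=> Hv; rewrite -rep_mul [m + n]addrC wG_wND repB Hv subr0 rep_int.
have updn m v : rho (wH n m) v = 0 ->
    rho (- wD) (rho (wG (m + n)) v) = m%:~R *: v.
  by move=> Hv; rewrite -rep_mul [m + n]addrC wND_wG repB Hv subr0 rep_int.
split=> // m v Hv.
  rewrite -[wH _ _](subKr (m + 1)%:~R) -wND_wG repB (rep_mul rho (- wD)).
  by rewrite addrA [n + m]addrC dnup // linearZ rep_int subrr.
rewrite -[wH _ _](subKr (m - 1 + 1)%:~R) -wG_wND repB (rep_mul rho (wG _)) subrK.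
by rewrite addrA subrK [n + m]addrC updn // linearZ rep_int subrr.
Qed.

Lemma binomial_grid_wd : binomial_wd rho.
Proof.
split=> n m v.
- exact: (up_mem (horizontal_ladder m)).
- exact: (dn_mem (horizontal_ladder m)).
- exact: (up_mem (vertical_ladder n)).
- by rewrite [n + m]addrC; apply: (dn_mem (vertical_ladder n)).
Qed.

(** The right factor acts first, so the vertical walk starts at the corner (b.1, a.2), of level a.2
    + b.1. *)
Definition straight_walk (a b : int * int) : weyl K :=
  climb (- wD) wG (a.2 + b.1) (b.2 - a.2) * climb wM wL (a.1 + a.2) (b.1 - a.1).

Variable wd : binomial_wd rho.
Local Notation grd := (binomial_grid wd).

Lemma wM_vertical j k :
  wM * climb (- wD) wG j k = climb (- wD) wG (j + 1) k * wM :> weyl K.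
Proof.
apply: (climb_crossing (f := fun=> wM)) => i; last exact: wM_wG.
by rewrite mulrN mulNr wMDC.
Qed.

Lemma wL_vertical j k :
  wL (j + k) * climb (- wD) wG j k = climb (- wD) wG (j - 1) k * wL j :> weyl K.
Proof.
apply: climb_crossing => i; last exact: wL_wG.
by rewrite mulrN mulNr wD_wL.
Qed.

Lemma gpath_straight (a b : vertex grd) (p : gpath a b) :
  exists c : K, forall u : U rho a.1 a.2,
    val (gpath_op p u) = c *: rho (straight_walk a b) (val u).
Proof.
elim: p => [|b' d p [c IHp] e].
  exists 1 => u; rewrite /straight_walk !subrr !climb0 mulr1 rep_unit.
  by rewrite scale1r.
have kerP (u : U rho a.1 a.2) : rho (wH a.1 a.2) (ker_val u) = 0.
  exact/eqP/(ker_valP u).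
(* Vertical steps need the vector at the corner to lie in the kernel there. *)
have horP b1 v : rho (wH a.1 a.2) v = 0 ->
    rho (wH b1 a.2) (rho (climb wM wL (a.1 + a.2) (b1 - a.1)) v) = 0.
  move=> /(climb_mem (horizontal_ladder a.2) (b1 - a.1)).
  by rewrite addrCA subrr addr0.
case: e p IHp => {b' d} n m i def_i p IHp.
- have [k Hk] := up_climb (horizontal_ladder a.2) a.1 (n - a.1).
  exists (c * k) => u; rewrite /= IHp linearZ -rep_mul -scalerA; congr (_ *: _).
  rewrite /straight_walk /= mulrA wM_vertical -mulrA rep_mul Hk //.
  by rewrite linearZ -rep_mul def_i addrA [n + 1 - _]addrAC.
- have [k Hk] := dn_climb (horizontal_ladder a.2) a.1 (n - a.1).
  exists (c * k) => u; rewrite /= IHp linearZ -rep_mul -scalerA; congr (_ *: _).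
  (* The level is split as corner level plus vertical displacement, as [wL_vertical] requires. *)
  have -> : n + m = a.2 + n + (m - a.2) by ring.
  rewrite /straight_walk /= mulrA wL_vertical -mulrA rep_mul.
  have -> : a.2 + n = a.1 + (n - a.1) + a.2 by ring.
  rewrite Hk // linearZ -rep_mul def_i.
  by congr (_ *: rho (climb _ _ _ _ * climb _ _ _ _) _); ring.
- have [k Hk] := up_climb (vertical_ladder n) a.2 (m - a.2).
  exists (c * k) => u; rewrite /= IHp linearZ -rep_mul -scalerA; congr (_ *: _).
  rewrite /straight_walk /= mulrA rep_mul Hk ?horP //.
  by rewrite -rep_mul def_i [m + 1 - _]addrAC.
- have [k Hk] := dn_climb (vertical_ladder n) a.2 (m - a.2).
  exists (c * k) => u; rewrite /= IHp linearZ -rep_mul -scalerA; congr (_ *: _).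
  have -> : n + m = a.2 + (m - a.2) + n by ring.
  rewrite /straight_walk /= mulrA rep_mul Hk ?horP //.
  by rewrite -rep_mul def_i [m - 1 - _]addrAC.
Qed.

Lemma binomial_SIE : SIE grd.
Proof.
move=> a p; have [c Hc] := gpath_straight p.
exists c => u; apply: val_inj; rewrite Hc.
by rewrite /straight_walk !subrr !climb0 mulr1 rep_unit.
Qed.

Lemma circuit_isP n m (p : @circuit K grd (n, m)) (t : weyl K) (c : K) :
    (forall u, val (gpath_op p u) = rho t (val u)) ->
    (forall v, rho (wH n m) v = 0 -> rho t v = c *: v) ->
  circuit_is p t c.
Proof.
move=> pt tc u; split=> //; apply: val_inj; rewrite pt.
by apply: tc; apply/eqP/(ker_valP u).
Qed.

End Binomial.

(** * The six named circuits *)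

Theorem theorem8 (R : realType) (V : lmodType R[i])
    (rho : representation (weyl R[i]) V) :
  exists wd : binomial_wd rho,
    SIE (binomial_grid wd) /\
    forall n m : int,
      [/\ circuit_is (east_narrow wd n m)
            (wL (n + m + 1) * wM) (n + 1)%:~R,
          circuit_is (west_narrow wd n m)
            (wM * wL (n + m)) n%:~R,
          circuit_is (north_narrow wd n m)
            (wG (n + m + 1) * (- wD)) (m + 1)%:~R,
          circuit_is (south_narrow wd n m)
            (- wD * wG (n + m)) m%:~R
        & circuit_is (ccw_square wd n m)
            (wG (n + m + 1) * wL (n + m + 2) * (- wD) * wM)
            ((n + 1)%:~R * (m + 1)%:~R) /\
          circuit_is (cw_square wd n m)
            (wL (n + m + 1) * wG (n + m + 2) * wM * (- wD))
            ((n + 1)%:~R * (m + 1)%:~R)].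
Proof.

exists (binomial_grid_wd rho); split=> [|n m]; first exact: binomial_SIE.
have horL := horizontal_ladder rho; have verL := vertical_ladder rho.
have E2 : n + m + 2 = n + m + 1 + 1 by ring.
have dn_upG v : rho (wH n m) v = 0 ->
    rho (wG (n + m + 1)) (rho (- wD) v) = (m + 1)%:~R *: v.
  by rewrite [n + m]addrC; apply: (dn_up (verL n)).
split; [| | | |split]; apply: circuit_isP => [u|v Hv] /=.
- by rewrite rep_mul addrAC.
- by rewrite rep_mul (dn_up (horL m)).
- by rewrite rep_mul.
- by rewrite rep_mul (up_dn (horL m)).
- by rewrite (rep_mul rho (wG _)) addrA.
- by rewrite (rep_mul rho (wG _)) dn_upG.
- by rewrite (rep_mul rho (- wD)).
- by rewrite (rep_mul rho (- wD)) [n + m]addrC (up_dn (verL n)).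
- have -> : n + m + 2 = n + 1 + (m + 1) by ring.
  rewrite (rep_mul rho _ wM) (rep_mul rho _ (- wD)) (rep_mul rho (wG _)).
  by rewrite addrA.
(* Commuting -D with L splits the square into the north narrow circuit after the east one. *)
- have -> : wG (n + m + 1) * wL (n + m + 2) * - wD * wM =
      wG (n + m + 1) * - wD * (wL (n + m + 1) * wM) :> weyl R[i].
    rewrite -[wG _ * _ * - wD]mulrA mulrN E2 -wD_wL.
    by rewrite -mulNr !mulrA.
  rewrite (rep_mul rho _ (_ * wM)) (rep_mul rho (wG _)) (rep_mul rho (wL _)).
  by rewrite (dn_up (horL m)) // !linearZ /= dn_upG // scalerA.
- have -> : n + m + 2 = n + 1 + (m + 1) by ring.
  rewrite (rep_mul rho _ (- wD)) (rep_mul rho _ wM) (rep_mul rho (wL _)).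
  by rewrite [n + m + 1]addrAC.
(* Likewise, commuting M with G puts the east narrow circuit after the north one. *)
- have -> : wL (n + m + 1) * wG (n + m + 2) * wM * - wD =
      wL (n + m + 1) * wM * (wG (n + m + 1) * - wD) :> weyl R[i].
    by rewrite E2 -[wL _ * _ * wM]mulrA -wM_wG !mulrA.
  rewrite (rep_mul rho _ (_ * - wD)) (rep_mul rho (wL _)) (rep_mul rho (wG _)).
  by rewrite dn_upG // !linearZ /= (dn_up (horL m)) // scalerA mulrC.
Qed.
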